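(* Let $n\ge 1$. The space of quasisymmetric harmonics $\mathrm{HQSym}_n$ is spanned over $\mathbb{Q}$ by the (iterated partial) derivatives of the homogeneous degree $n-1$ elements of $\mathrm{HQSym}_n$.
   Context: $\mathrm{QSym}_n\subset \mathbb{Z}[x_1,\ldots,x_n]$ is the ring of polynomials such that for every sequence $a_1,\ldots,a_k\ge 1$ the coefficients of $x_{i_1}^{a_1}\cdots x_{i_k}^{a_k}$ and $x_{j_1}^{a_1}\cdots x_{j_k}^{a_k}$ are equal whenever $1\le i_1<\cdots<i_k\le n$ and $1\le j_1<\cdots<j_k\le n$. The quasisymmetric harmonics are $$\mathrm{HQSym}_n=\{f\in\mathbb{Q}[\lambda_1,\ldots,\lambda_n]: g(\tfrac{\partial}{\partial\lambda_1},\ldots,\tfrac{\partial}{\partial\lambda_n})f=0\text{ for all }g\in\mathrm{QSym}_n\text{ with zero constant term}\}.$$ Derivatives of $g$ means all $\left(\tfrac{\partial}{\partial\lambda_1}\right)^{c_1}\cdots\left(\tfrac{\partial}{\partial\lambda_n}\right)^{c_n}g$ with $c_1,\ldots,c_n\ge 0$, including $g$ itself. *)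

(* Defs.v *)
From HB Require Import structures.
From mathcomp Require Import all_boot all_order all_algebra.
From mathcomp.multinomials Require Import mpoly.

Set Implicit Arguments.
Unset Strict Implicit.
Unset Printing Implicit Defensive.

Import GRing.Theory.
Local Open Scope ring_scope.

Definition strictly_increasing (k n : nat) (i : 'I_k -> 'I_n) : Prop :=
  forall s t : 'I_k, (s < t)%N -> (i s < i t)%N.

(* The exponent of x_{i_1}^{a_1} ... x_{i_k}^{a_k}. *)
Definition pattern_mnm (k n : nat) (a : 'I_k -> nat) (i : 'I_k -> 'I_n) :
    'X_{1..n} :=
  (\big[mnm_add/mnm0]_(t < k) (U_(i t) *+ a t))%MM.

Definition QSym (n : nat) (g : {mpoly int[n]}) : Prop :=
  forall (k : nat) (a : 'I_k -> nat), (forall t, (1 <= a t)%N) ->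
  forall i j : 'I_k -> 'I_n,
    strictly_increasing i -> strictly_increasing j ->
    g@_(pattern_mnm a i) = g@_(pattern_mnm a j).

(* g(d/dl_1, ..., d/dl_n) f *)
Definition apply_diffop (n : nat) (g : {mpoly int[n]}) (f : {mpoly rat[n]}) :
    {mpoly rat[n]} :=
  \sum_(m <- msupp g) (g@_m)%:~R *: mderivm m f.

Definition HQSym (n : nat) (f : {mpoly rat[n]}) : Prop :=
  forall g : {mpoly int[n]}, QSym g -> g@_0%MM = 0 -> apply_diffop g f = 0.

Definition in_span (K : nzRingType) (V : lmodType K) (S : V -> Prop) (v : V) :
    Prop :=
  exists (r : nat) (c : 'I_r -> K) (w : 'I_r -> V),
    (forall t, S (w t)) /\ v = \sum_(t < r) c t *: w t.

Definition derivative_of (n : nat) (S : {mpoly rat[n]} -> Prop)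
    (h : {mpoly rat[n]}) : Prop :=
  exists (c : 'X_{1..n}) (g : {mpoly rat[n]}), S g /\ h = mderivm c g.

(* Main.v *)
Require Import Defs.
From mathcomp Require Import all_boot all_order all_algebra.
From mathcomp.multinomials Require Import mpoly.
From mathcomp Require Import zify.

Set Implicit Arguments.
Unset Strict Implicit.
Unset Printing Implicit Defensive.

Import GRing.Theory.
Local Open Scope ring_scope.

(** Identify a polynomial f in lambda_1, ..., lambda_n with the functional
    phi : nu |-> (d^nu f)(0) on exponent vectors of length n. A polynomial g
    acts through g(d/dlambda), that is phi |-> (nu |-> phi(x^nu g)), and f is
    harmonic exactly when phi vanishes on the ideal generated by the
    quasisymmetric polynomials without constant term.

    The theorem follows from two facts, in which H(n, d) is the space of
    harmonics of degree d in n variables.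
    - [harmonic_top]: H(n, d) = 0 for d >= n >= 1.
    - [deriv0_onto_intg_spans]: d/dlambda_1 maps H(n, d+1) onto H(n, d) whenever
      d + 1 < n.
    Indeed the homogeneous components of a harmonic polynomial are harmonic, and
    the component of degree d < n is then (d/dlambda_1)^(n-1-d) of an element
    of H(n, n-1).

    Surjectivity. The integral of f(..., lambda_(i-1), z, lambda_(i+2), ...) for
    z from lambda_(i+1) to lambda_i is the adjoint V_i of the operator
    T_i g = (g(.., x_i, 0, ..) - g(.., 0, x_i, ..)) / x_i. A quasisymmetric q is
    killed by every T_i, so that T_i (q g) = q' T_i g with q' the quasisymmetric
    polynomial q(.., 0, ..) in n - 1 variables, and V_i maps harmonics in n - 1
    variables to harmonics in n variables. V_i commutes with
    D = d/dlambda_1 for i > 1, and V_1 D = D V_1 - E where E regards a function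
    of n - 1 variables as one of lambda_2, ..., lambda_n. The kernel of D on
    H(n, d) is E H(n-1, d). By a joint induction on n,
    H(n, d+1) = sum_i V_i H(n-1, d) and D : H(n, d+1) -> H(n, d) is onto for
    d + 1 < n: the commutation rules lift preimages under D from n - 1 to n
    variables, and once h and some v in the sum of the images of the V_i have
    the same image under D, h - v is in E H(n-1, d+1), which is in that sum by
    the induction hypothesis. (For d + 1 >= n there is only h = 0.)

    Vanishing. A stronger statement goes by induction on the number of
    variables: the ideal generated by the fundamental quasisymmetric
    polynomials F_alpha(x_1, ..., x_m) with |alpha| - length(alpha) >= p contains
    every monomial of degree m + p. The relations
    F_(c,beta)(x_1, X) = sum_(j < c) x_1^j F_(c-j,beta)(X) + x_1^c F_beta(X)
    show that, modulo terms with lower powers of x_1, the ideal contains x_1^c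
    times its analogue for m - 1 variables and p + 1 - c, hence x_1^c times every
    monomial of degree m + p - c in the other variables; the lower powers are
    dealt with by induction on c. The case p = 0 is the vanishing of H(m, m). *)

(** * The action of monomial quasisymmetric polynomials *)

Section Functionals.

Variable K : zmodType.
Implicit Types (phi psi : seq nat -> K) (s nu alpha beta gamma : seq nat).

(** The value at x^nu of M_alpha acting on phi, that is the sum of
    phi(nu + alpha_1 e_(i_1) + ... + alpha_k e_(i_k)) over i_1 < ... < i_k. The
    recursion on nu, according to whether i_1 is the first index, is what makes
    the proofs below inductive in the number of variables; phi is arbitrary
    on lists of the wrong length, hence the conditions on sizes below. *)
Fixpoint mon_act alpha phi nu : K :=
  if nu is a :: nu' then
    mon_act alpha (fun s => phi (a :: s)) nu' +
    (if alpha is b :: beta then mon_act beta (fun s => phi (a + b :: s)%N) nu'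
     else 0)
  else if alpha is [::] then phi [::] else 0.

Lemma mon_act_cons b beta phi a nu :
  mon_act (b :: beta) phi (a :: nu) =
  mon_act (b :: beta) (fun s => phi (a :: s)) nu +
  mon_act beta (fun s => phi (a + b :: s)%N) nu.
Proof. by []. Qed.

Definition positive alpha := all (leq 1) alpha.

Definition harmonic n phi :=
  forall alpha, alpha != [::] -> positive alpha ->
  forall nu, size nu = n -> mon_act alpha phi nu = 0.

Definition homogeneous (n d : nat) phi :=
  forall nu, size nu = n -> sumn nu != d -> phi nu = 0.

Lemma eq_mon_act alpha phi psi nu :
    (forall s, size s = size nu -> sumn s = (sumn alpha + sumn nu)%N ->
      phi s = psi s) ->
  mon_act alpha phi nu = mon_act alpha psi nu.
Proof.
elim: nu alpha phi psi => [|a nu IH] [|b beta] phi psi eqf //=; try exact: eqf.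
  congr (_ + _); apply: IH => s sz sm; apply: eqf; rewrite /= ?sz //.
  by rewrite sm; rewrite /=; lia.
congr (_ + _); apply: IH => s sz sm; apply: eqf; rewrite /= ?sz // sm /=; lia.
Qed.

Lemma mon_act0 alpha nu : mon_act alpha (fun=> 0) nu = 0.
Proof.
elim: nu alpha => [|a nu IH] [|b beta] //=; rewrite !IH ?addr0 //.
Qed.

Lemma mon_act_eq0 alpha phi nu :
    (forall s, size s = size nu -> sumn s = (sumn alpha + sumn nu)%N ->
      phi s = 0) ->
  mon_act alpha phi nu = 0.
Proof. by move=> h; rewrite (@eq_mon_act _ _ (fun=> 0)) ?mon_act0. Qed.

Lemma mon_actD alpha phi psi nu :
  mon_act alpha (fun s => phi s + psi s) nu =
  mon_act alpha phi nu + mon_act alpha psi nu.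
Proof.
elim: nu alpha phi psi => [|a nu IH] [|b beta] phi psi /=.
- by [].
- by rewrite addr0.
- by rewrite !addr0 IH.
- by rewrite !IH addrACA.
Qed.

Lemma mon_actN alpha phi nu :
  mon_act alpha (fun s => - phi s) nu = - mon_act alpha phi nu.
Proof.
elim: nu alpha phi => [|a nu IH] [|b beta] phi //=; rewrite ?oppr0 ?addr0 //.
by rewrite !IH opprD.
Qed.

Lemma mon_act_nil phi nu : mon_act [::] phi nu = phi nu.
Proof. by elim: nu phi => //= a nu IH phi; rewrite addr0 IH. Qed.

(** * Vanishing in degree at least the number of variables *)

Local Arguments mon_act : simpl never.

(** A list [gamma] encodes the composition of parts [c.+1] for c in [gamma], so
    that [sumn gamma] is |alpha| - length(alpha), the parameter of the induction.
    F_alpha is the sum of M_beta over the refinements beta of alpha. In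
    [refine_head b c R] a first block of total b + c is being split, b is the
    part of its first piece already decided, and R refines the other parts. *)
Fixpoint refine_head b c (R : seq (seq nat)) : seq (seq nat) :=
  if c is c'.+1 then
    refine_head b.+1 c' R ++ map (cons b) (refine_head 1 c' R)
  else map (cons b) R.

Fixpoint refinements gamma : seq (seq nat) :=
  if gamma is c :: gamma' then refine_head 1 c (refinements gamma')
  else [:: [::]].

Definition fund_act gamma phi nu : K :=
  \sum_(alpha <- refinements gamma) mon_act alpha phi nu.

(** F_alpha sums x_(i_1) ... x_(i_d) over words that increase weakly inside the
    blocks of alpha and strictly between them. Either no letter is the first
    variable, or the first letter is, and what remains is a word of the same
    kind, still starting at the first variable inside a block, but after it at
    the end of a block. *)
Lemma sum_refine_head b c R phi a nu :
  \sum_(alpha <- refine_head b c R) mon_act alpha phi (a :: nu) =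
  \sum_(alpha <- refine_head b c R) mon_act alpha (fun s => phi (a :: s)) nu +
  (if c is c'.+1 then
     \sum_(alpha <- refine_head 1 c' R) mon_act alpha phi (a + b :: nu)%N
   else \sum_(alpha <- R) mon_act alpha (fun s => phi (a + b :: s)%N) nu).
Proof.
elim: c b a => [|c IH] b a /=; first by rewrite !big_map -big_split.
rewrite !big_cat !big_map /= IH.
under [X in _ + _ + X = _]eq_bigr do rewrite mon_act_cons.
rewrite big_split /= IH addrACA; congr (_ + _).
by rewrite addrC addnS addn1.
Qed.

Lemma fund_act_cons c gamma phi a nu :
  fund_act (c :: gamma) phi (a :: nu) =
  fund_act (c :: gamma) (fun s => phi (a :: s)) nu +
  (if c is c'.+1 then fund_act (c' :: gamma) phi (a.+1 :: nu)
   else fund_act gamma (fun s => phi (a.+1 :: s)) nu).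
Proof. by rewrite /fund_act /= sum_refine_head addn1. Qed.

Lemma fund_act_eq0 gamma phi nu :
  (forall s, size s = size nu -> phi s = 0) -> fund_act gamma phi nu = 0.
Proof. by move=> h; apply: big1 => alpha _; apply: mon_act_eq0 => s /h. Qed.

(** The part of F_(c+1,gamma) divisible by the highest possible power of the
    first variable has cofactor F_gamma in the other variables. *)
Lemma fund_act_lead c gamma phi a nu :
    (forall j, (a <= j <= a + c)%N ->
      forall s, size s = size nu -> phi (j :: s) = 0) ->
  fund_act (c :: gamma) phi (a :: nu) =
  fund_act gamma (fun s => phi ((a + c).+1 :: s)) nu.
Proof.
elim: c a => [|c IH] a h; rewrite fund_act_cons fund_act_eq0 ?add0r.
- by rewrite addn0.
- by apply: h; lia.
- by rewrite IH ?addSnnS // => j hj; apply: h; lia.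
- by apply: h; lia.
Qed.

(** Dropping the first variable costs one unit of |alpha| - length(alpha):
    F_(a,beta)(X) - F_(a,beta)(x_1, X) is - x_1 F_(a-1,beta)(x_1, X) if a > 1, and
    - x_1 F_beta(X) with an unchanged parameter if a = 1. *)
Lemma fund_act_tail m p phi :
    (forall gamma nu, gamma != [::] -> (p <= sumn gamma)%N -> size nu = m.+1 ->
      fund_act gamma phi nu = 0) ->
  forall gamma j nu, (p < sumn gamma)%N -> size nu = m ->
    fund_act gamma (fun s => phi (j :: s)) nu = 0.
Proof.
move=> kill; elim=> [|c gamma IH] j nu //= hp sz.
have := fund_act_cons c gamma phi j nu.
rewrite kill //= ?sz //; last lia.
case: c hp => [|c] hp; first by rewrite IH ?addr0.
by rewrite (kill (c :: gamma)) ?addr0 //= ?sz //; lia.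
Qed.

(** Dual form of the statement that the F_alpha in m variables with
    |alpha| - length(alpha) >= p generate an ideal containing all monomials of
    degree m + p. Restricting phi to a single degree lets the terms with a lower
    power of the first variable vanish outright, instead of being carried along
    as a correction. *)
Lemma fund_killed_eq0 m p phi : (0 < m + p)%N -> homogeneous m (m + p)%N phi ->
    (forall gamma nu, gamma != [::] -> (p <= sumn gamma)%N -> size nu = m ->
      fund_act gamma phi nu = 0) ->
  forall s, size s = m -> phi s = 0.
Proof.
elim: m p phi => [|m IH] p phi mp_gt0 hom kill s.
  by move/size0nil->; apply: hom => //=; lia.
case: s => // c s [sz]; elim/ltn_ind: c s sz => c IHc s sz.
have [lt_pc|le_cp] := ltnP p c.
  (* For c > p the one-part composition (c) is allowed, and the cofactor of
     x_1^c in F_(c) is 1. *)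
  case: c lt_pc IHc => // c lt_pc IHc.
  have := @fund_act_lead c [::] phi 0%N s.
  rewrite kill //= ?sz //; last lia.
  by rewrite /fund_act big_seq1 mon_act_nil => <-.
(* Otherwise phi restricted to the exponent c is a functional in m variables
   of degree m + (p + 1 - c). *)
apply: (IH (p.+1 - c)%N (fun s => phi (c :: s))) => //; first lia.
  by move=> nu sz' sm; apply: hom => /=; [rewrite sz'|lia].
move=> gamma nu nz hg sz'.
case: c IHc le_cp hg => [|c] IHc le_cp hg.
  by apply: (fund_act_tail kill) => //; lia.
have := @fund_act_lead c gamma phi 0%N nu.
rewrite kill //= ?sz' //; last lia.
by move=> <-.
Qed.

Lemma refine_head_positive b c R : (0 < b)%N -> all positive R ->
  all (fun alpha => (alpha != [::]) && positive alpha) (refine_head b c R).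
Proof.
move=> b_gt0 posR.
have weak P : all (fun alpha => (alpha != [::]) && positive alpha) P ->
    all positive P by apply: sub_all => x /andP[].
elim: c b b_gt0 => [|c IH] b b_gt0 /=.
  by rewrite all_map; apply: sub_all posR => x /= ->; rewrite b_gt0.
rewrite all_cat IH //= all_map.
by apply: sub_all (weak _ (IH 1%N isT)) => x /= ->; rewrite b_gt0.
Qed.

Lemma refinements_positive gamma : all positive (refinements gamma).
Proof.
elim: gamma => //= c gamma IH.
by apply: sub_all (@refine_head_positive 1 c _ isT IH) => x /andP[].
Qed.

Lemma harmonic_fund_act n phi gamma nu :
  harmonic n phi -> gamma != [::] -> size nu = n -> fund_act gamma phi nu = 0.
Proof.
case: gamma => // c gamma hphi _ sz; rewrite /fund_act big_seq big1 // => al.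
move/(allP (@refine_head_positive 1 c _ isT (refinements_positive gamma))).
by case/andP=> nz pos; apply: hphi.
Qed.

(** All F_alpha with alpha nonempty kill a harmonic functional, which allows
    every p >= 0, in particular p = d - n. *)
Lemma harmonic_top n d phi : (0 < n <= d)%N ->
  harmonic n phi -> homogeneous n d phi ->
  forall s, size s = n -> phi s = 0.
Proof.
move=> hnd hphi hom; apply: (@fund_killed_eq0 n (d - n)); first lia.
  by rewrite subnKC //; case/andP: hnd.
by move=> gamma nu nz _; apply: harmonic_fund_act.
Qed.

(** * Integration operators, extension and the first derivative *)

Local Arguments mon_act : simpl nomatch.

(** The adjoint of T_(i+1), i.e. [intg i phi] is nu |-> phi(T_(i+1) x^nu). The
    polynomial T_(i+1) x^nu is nonzero only if exactly one of the two adjacent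
    exponents at positions i, i+1 is zero; it is then, up to sign, the monomial
    in which this zero is removed and the other exponent lowered by one. In
    terms of polynomials, this is integration from lambda_(i+2) to
    lambda_(i+1) of the merged variable. *)
Fixpoint intg i phi s : K :=
  match i, s with
  | 0, a.+1 :: 0 :: v => phi (a :: v)
  | 0, 0 :: b.+1 :: v => - phi (b :: v)
  | i'.+1, a :: s' => intg i' (fun t => phi (a :: t)) s'
  | _, _ => 0
  end.

(** The operator E of the overview: one more variable, placed first, on which the
    polynomial does not depend. *)
Definition ext0 phi s : K := if s is 0 :: s' then phi s' else 0.

Lemma eq_intg i phi psi s :
  (forall t, (size t).+1 = size s -> (sumn t).+1 = sumn s -> phi t = psi t) ->
  intg i phi s = intg i psi s.
Proof.
elim: i phi psi s => [|i IH] phi psi [|a s] //= h; last first.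
  by apply: IH => t szt smt; apply: h => /=; lia.
case: a h => [|a] h; case: s h => [|[|b] v] h //=; rewrite h //=; lia.
Qed.

Lemma intg_eq0 i phi s :
  (forall t, (size t).+1 = size s -> (sumn t).+1 = sumn s -> phi t = 0) ->
  intg i phi s = 0.
Proof.
move=> h; rewrite (@eq_intg _ _ (fun=> 0)) {h}//.
elim: i s => [|i IH] [|[|a] [|[|b] s]] //=; rewrite ?oppr0 ?IH //.
Qed.

Lemma intgD i phi psi s :
  intg i (fun t => phi t + psi t) s = intg i phi s + intg i psi s.
Proof.
elim: i phi psi s => [|i IH] phi psi [|a s]; rewrite /= ?addr0 //.
case: a s => [|a] [|[|b] s]; rewrite /= ?addr0 ?opprD //.
Qed.

(** T_i (M_alpha g) = M_alpha T_i g. For the two merged variables, the terms of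
    M_alpha using both are invisible to T_i, and those using one of them cancel
    or combine according to which exponents of nu are zero. *)
Lemma mon_act_intg i alpha phi nu : positive alpha ->
  mon_act alpha (intg i phi) nu = intg i (mon_act alpha phi) nu.
Proof.
elim: i alpha phi nu => [|i IH] alpha phi nu.
  case: nu => [|a [|b v]]; first by case: alpha.
    by move=> _; case: alpha => [|x [|y alpha]]; case: a => [|a];
       rewrite /= ?add0n ?addr0 ?add0r ?mon_act_nil //; case: x.
  case: alpha => [|x alpha] /=.
    by move=> _; rewrite !addr0 !mon_act_nil; case: a b => [|a] [|b];
       rewrite ?addr0 ?mon_act_nil.
  case/andP; case: x => // x _ pos.
  set both := (X in _ + (_ + X) = _); have {both}-> : both = 0.
    rewrite {}/both; case: alpha pos => // -[|y] alpha //= _.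
    by apply: mon_act_eq0 => s _ _; rewrite !addnS.
  rewrite addr0 !addnS.
  case: a b => [|a] [|b]; rewrite /= ?add0n ?mon_actN ?mon_act0 ?add0r ?addr0 //.
  - by rewrite addNr.
  - by rewrite -opprD addSnnS.
  - by rewrite addSnnS.
case: nu => [|a nu] pos; first by case: alpha pos.
case: alpha pos => [|x alpha] pos /=.
  by rewrite addr0 IH //; apply: eq_intg => t _ _; rewrite addr0.
by rewrite !IH -?intgD //; case/andP: pos.
Qed.

Lemma harmonic_intg n i phi : harmonic n phi -> harmonic n.+1 (intg i phi).
Proof.
move=> h alpha nz pos nu sz; rewrite mon_act_intg //; apply: intg_eq0 => t szt _.
by apply: h => //; lia.
Qed.

Lemma homogeneous_intg n d i phi :
  homogeneous n d phi -> homogeneous n.+1 d.+1 (intg i phi).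
Proof.
by move=> h nu sz sm; apply: intg_eq0 => t szt smt; apply: h; lia.
Qed.


Lemma harmonicD n phi psi : harmonic n phi -> harmonic n psi ->
  harmonic n (fun s => phi s + psi s).
Proof.
by move=> h h' alpha nz pos nu sz; rewrite mon_actD h ?h' ?addr0.
Qed.

Lemma harmonicN n phi : harmonic n phi -> harmonic n (fun s => - phi s).
Proof. by move=> h alpha nz pos nu sz; rewrite mon_actN h ?oppr0. Qed.

Lemma eq_harmonic n phi psi : (forall s, size s = n -> phi s = psi s) ->
  harmonic n phi -> harmonic n psi.
Proof.
move=> e h alpha nz pos nu sz; rewrite -(h alpha nz pos nu sz).
by apply: eq_mon_act => s ss _; rewrite e ?ss.
Qed.

Lemma sumn_positive alpha : alpha != [::] -> positive alpha -> (0 < sumn alpha)%N.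
Proof. by case: alpha => //= x alpha _ /andP[]; lia. Qed.

Lemma harmonic_homogeneous0 n phi : homogeneous n 0 phi -> harmonic n phi.
Proof.
move=> hom alpha nz pos nu sz; apply: mon_act_eq0 => s ss sm.
by apply: hom; have := sumn_positive nz pos; lia.
Qed.

(** The derivative with respect to the first variable. *)
Definition deriv0 phi s : K := if s is a :: s' then phi (a.+1 :: s') else 0.

Lemma harmonic_deriv0 n phi : harmonic n.+1 phi -> harmonic n.+1 (deriv0 phi).
Proof.
by move=> h alpha nz pos [|a nu] //= sz; apply: (h alpha nz pos (a.+1 :: nu) sz).
Qed.

Lemma homogeneous_deriv0 n d phi :
  homogeneous n d.+1 phi -> homogeneous n d (deriv0 phi).
Proof. by move=> h [|a nu] //= sz sm; apply: h => //=; lia. Qed.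

Lemma harmonic_ext0 n phi : harmonic n phi -> harmonic n.+1 (ext0 phi).
Proof.
move=> h [|x alpha] // nz pos [|a nu] //= [sz].
have /andP[x_gt0 _] := pos.
rewrite [X in _ + X]mon_act_eq0 ?addr0; last first.
  by case: (a + x)%N (addn_eq0 a x) => //; lia.
by case: a => [|a]; rewrite ?h // mon_act0.
Qed.

Lemma homogeneous_ext0 n d phi :
  homogeneous n d phi -> homogeneous n.+1 d (ext0 phi).
Proof. by move=> h [|[|a] nu] //= [sz] sm; apply: h. Qed.

(** A harmonic polynomial that does not depend on the first variable is harmonic
    in the others: the terms of M_alpha that use the first variable act by 0. *)
Lemma harmonic_head0 n phi : harmonic n.+1 phi ->
  (forall s, size s = n.+1 -> deriv0 phi s = 0) ->
  harmonic n (fun s => phi (0 :: s)%N).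
Proof.
move=> h k [|x alpha] // nz pos nu sz.
have := h _ nz pos (0%N :: nu); rewrite /= sz => /(_ erefl).
rewrite [X in _ + X]mon_act_eq0 ?addr0 // => s ss _.
have /andP[x_gt0 _] := pos.
by have := k (x.-1 :: s); rewrite /= prednK // add0n; apply; lia.
Qed.

Lemma ext0_intg i phi s : ext0 (intg i phi) s = intg i.+1 (ext0 phi) s.
Proof.
by case: s => [|[|a] s] //=; rewrite intg_eq0.
Qed.

Lemma deriv0_intgS i phi s : deriv0 (intg i.+1 phi) s = intg i.+1 (deriv0 phi) s.
Proof. by case: s. Qed.

(** For the merged variable z of phi, integration of dphi/dz gives the difference
    of phi at z = lambda_1 and at z = lambda_2; the former is the derivative of
    the integral with respect to lambda_1. *)
Lemma intg0_deriv0 phi s : (1 < size s)%N ->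
  intg 0 (deriv0 phi) s = deriv0 (intg 0 phi) s - ext0 phi s.
Proof.
by case: s => [|[|a] [|[|b] s]] //= _; rewrite ?subrr ?sub0r ?subr0.
Qed.

Definition harmonic_deg (n d : nat) phi := harmonic n phi /\ homogeneous n d phi.

(** The sum of the images of the operators V_i on the harmonics in n variables
    of degree d; its elements live in n + 1 variables and degree d + 1. An
    inductive predicate gives constructions that are linear in the generators
    by induction on the derivation. *)
Inductive intg_span (n d : nat) : (seq nat -> K) -> Prop :=
| IntgSpan0 : intg_span n d (fun=> 0)
| IntgSpan1 i phi : harmonic_deg n d phi -> intg_span n d (intg i phi)
| IntgSpanD phi psi : intg_span n d phi -> intg_span n d psi ->
    intg_span n d (fun s => phi s + psi s)
| IntgSpanE phi psi : intg_span n d phi ->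
    (forall s, size s = n.+1 -> phi s = psi s) -> intg_span n d psi.

Lemma intg_span_harmonic n d phi : intg_span n d phi -> harmonic_deg n.+1 d.+1 phi.
Proof.
elim=> {phi}.
- by split=> // alpha _ _ nu _; rewrite mon_act0.
- by move=> i phi [h h']; split; [apply: harmonic_intg|apply: homogeneous_intg].
- move=> phi psi _ [h1 h2] _ [h3 h4]; split; first exact: harmonicD.
  by move=> nu sz sm; rewrite h2 ?h4 ?addr0.
- move=> phi psi _ [h1 h2] e; split; first exact: eq_harmonic h1.
  by move=> nu sz sm; rewrite -e ?h2.
Qed.

Lemma intg_span_ext0 n d phi :
  intg_span n d phi -> intg_span n.+1 d (ext0 phi).
Proof.
elim=> {phi}.
- by apply: IntgSpanE (IntgSpan0 _ _) _ => -[|[|a] s].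
- move=> i phi [h h']; apply: (@IntgSpanE _ _ (intg i.+1 (ext0 phi))).
    by apply: IntgSpan1; split; [apply: harmonic_ext0|apply: homogeneous_ext0].
  by move=> s _; rewrite ext0_intg.
- move=> phi psi _ h1 _ h2; apply: IntgSpanE (IntgSpanD h1 h2) _.
  by move=> [|[|a] s] //= _; rewrite addr0.
- move=> phi psi _ h1 e; apply: IntgSpanE h1 _.
  by move=> [|[|a] s] //= [sz]; rewrite e.
Qed.

(** * Harmonics are integrals, and the first derivative is onto *)

Definition deriv0_onto n := forall d phi, (d < n)%N -> harmonic_deg n.+1 d phi ->
  exists2 psi, harmonic_deg n.+1 d.+1 psi &
    forall s, size s = n.+1 -> deriv0 psi s = phi s.

Definition intg_spans n :=
  forall d phi, harmonic_deg n.+1 d.+1 phi -> intg_span n d phi.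

(** A constant c is the derivative of c (lambda_1 - lambda_2), which needs two
    variables. *)
Lemma deriv0_onto_deg0 n phi : harmonic_deg n.+2 0 phi ->
  exists2 psi, intg_span n.+1 0 psi &
    forall s, size s = n.+2 -> deriv0 psi s = phi s.
Proof.
case=> _ hom; exists (intg 0 (fun s => phi (0 :: s)%N)).
  apply: IntgSpan1.
  have h : homogeneous n.+1 0 (fun s => phi (0%N :: s)).
    by move=> nu sz sm; apply: hom => //=; rewrite sz.
  by split=> //; apply: harmonic_homogeneous0.
move=> [|a [|b v]] //= sz.
have z c e : (c + e != 0)%N -> phi [:: c, e & v] = 0.
  by move=> ce; apply: hom => //=; lia.
case: b sz => [|b] sz; last by rewrite z //; lia.
by case: a sz => [|a] sz //; rewrite !z //; lia.
Qed.

Section Step.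

Variable n : nat.
Hypotheses (IHonto : deriv0_onto n) (IHspan : intg_spans n).

(** Here E V_i = V_(i+1) E moves the integration away from the first variable,
    so that it commutes with the derivative. *)
Lemma deriv0_onto_ext0 d phi : (d < n)%N -> intg_span n d phi ->
  exists2 psi, intg_span n.+1 d.+1 psi &
    forall s, size s = n.+2 -> deriv0 psi s = ext0 phi s.
Proof.
move=> dn; elim=> {phi}.
- by exists (fun=> 0) => [|[|[|a] s]] //; apply: IntgSpan0.
- move=> i phi [h1 h2].
  have [|psi hpsi e] := @IHonto d (ext0 phi) dn.
    by split; [apply: harmonic_ext0|apply: homogeneous_ext0].
  exists (intg i.+1 psi); first exact: IntgSpan1.
  move=> s sz; rewrite deriv0_intgS ext0_intg; apply: eq_intg => t szt _.
  by rewrite e //; lia.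
- move=> phi1 phi2 _ [psi1 h1 e1] _ [psi2 h2 e2].
  exists (fun s => psi1 s + psi2 s); first exact: IntgSpanD.
  move=> s sz; move: (e1 s sz) (e2 s sz).
  by case: s sz => [|[|a] s] //= _ -> -> //; rewrite addr0.
- move=> phi1 phi2 _ [psi1 h1 e1] e; exists psi1 => // s sz.
  by rewrite e1 //; case: s sz => [|[|a] s] //= [sz]; rewrite e.
Qed.

(** If phi = D psi in one variable less, then V_i phi = D V_i psi for i > 1, but
    V_1 phi = D V_1 psi - E psi, and the correction E psi has to be written as a
    derivative too: psi has positive degree, hence is itself a sum of integrals. *)
Lemma deriv0_onto_span d phi : (d < n)%N -> intg_span n.+1 d phi ->
  exists2 psi, intg_span n.+1 d.+1 psi &
    forall s, size s = n.+2 -> deriv0 psi s = phi s.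
Proof.
move=> dn; elim=> {phi}.
- by exists (fun=> 0) => [|[|[|a] s]] //; apply: IntgSpan0.
- move=> i phi hphi; have [psi hpsi e] := IHonto dn hphi.
  case: i => [|i]; last first.
    exists (intg i.+1 psi); first exact: IntgSpan1.
    move=> s sz; rewrite deriv0_intgS; apply: eq_intg => t szt _.
    by rewrite e //; lia.
  have [|chi hchi e'] := @deriv0_onto_ext0 d (fun s => - psi s) dn.
    apply: IHspan; case: hpsi => h1 h2; split; first exact: harmonicN.
    by move=> nu sz sm; rewrite h2 ?oppr0.
  exists (fun s => intg 0 psi s + chi s).
    by apply: IntgSpanD => //; apply: IntgSpan1.
  move=> s sz; rewrite -(@eq_intg 0 (deriv0 psi)); last first.
    by move=> t szt _; rewrite e //; lia.
  rewrite intg0_deriv0 ?sz //; have := e' s sz.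
  by case: s sz => [|a s] //= _ ->; case: a => [|a]; rewrite ?oppr0.
- move=> phi1 phi2 _ [psi1 h1 e1] _ [psi2 h2 e2].
  exists (fun s => psi1 s + psi2 s); first exact: IntgSpanD.
  by move=> s sz; rewrite -e1 // -e2 //; case: s sz.
- move=> phi1 phi2 _ [psi1 h1 e1] e; exists psi1 => // s sz.
  by rewrite e1 // e.
Qed.

(** An equality of first derivatives is enough, since the difference depends on
    one variable less, where it is a sum of integrals by hypothesis. *)
Lemma intg_span_of_deriv0 d phi psi : harmonic_deg n.+2 d.+1 phi ->
    intg_span n.+1 d psi ->
    (forall s, size s = n.+2 -> deriv0 psi s = deriv0 phi s) ->
  intg_span n.+1 d phi.
Proof.
move=> [hphi ophi] hpsi e; have [hpsi1 opsi] := intg_span_harmonic hpsi.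
pose theta s := phi (0 :: s)%N - psi (0 :: s)%N.
have htheta : harmonic_deg n.+1 d.+1 theta.
  split; last first.
    by move=> nu sz sm; rewrite /theta ophi ?opsi ?subr0 //= sz.
  apply: (@harmonic_head0 n.+1 (fun s => phi s - psi s)).
    by apply: harmonicD => //; apply: harmonicN.
  by move=> [|a s] //= /(e (a :: s)) /= ->; rewrite subrr.
apply: (IntgSpanE (IntgSpanD hpsi (intg_span_ext0 (IHspan htheta)))).
move=> [|[|a] s] //= sz; rewrite /theta; first by rewrite addrC subrK.
by rewrite addr0; apply: (e (a :: s)).
Qed.

Lemma intg_spans_step : intg_spans n.+1.
Proof.
move=> d phi; have [lt_nd|] := ltnP n d.
  move=> [hphi ophi]; apply: IntgSpanE (IntgSpan0 _ _) _ => s sz.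
  by rewrite (harmonic_top _ hphi ophi).
elim: d phi => [|d IHd] phi le_dn hphi.
  have [|psi hpsi e] := @deriv0_onto_deg0 n (deriv0 phi).
    by case: hphi => ? ?; split; [apply: harmonic_deriv0|apply: homogeneous_deriv0].
  exact: intg_span_of_deriv0 hphi hpsi e.
have [|psi hpsi e] := @deriv0_onto_span d (deriv0 phi) le_dn.
  apply: IHd; first exact: ltnW.
  by case: hphi => ? ?; split; [apply: harmonic_deriv0|apply: homogeneous_deriv0].
exact: intg_span_of_deriv0 hphi hpsi e.
Qed.

Lemma deriv0_onto_step : deriv0_onto n.+1.
Proof.
move=> [|d] phi lt_dn hphi.
  have [psi hpsi e] := deriv0_onto_deg0 hphi.
  by exists psi => //; apply: intg_span_harmonic.
have [psi hpsi e] := deriv0_onto_span lt_dn (intg_spans_step hphi).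
by exists psi => //; apply: intg_span_harmonic.
Qed.

End Step.

Lemma deriv0_onto_intg_spans n : deriv0_onto n /\ intg_spans n.
Proof.
elim: n => [|n [IH1 IH2]].
  split=> // d phi [hphi ophi]; apply: IntgSpanE (IntgSpan0 _ _) _ => s sz.
  by rewrite (harmonic_top _ hphi ophi).
by split; [apply: deriv0_onto_step|apply: intg_spans_step].
Qed.

Lemma harmonic_iter_deriv0 n k phi : (k <= n)%N -> harmonic_deg n.+1 (n - k)%N phi ->
  exists2 psi, harmonic_deg n.+1 n psi &
    forall a s, size s = n -> psi (k + a :: s)%N = phi (a :: s).
Proof.
elim: k phi => [|k IH] phi le_kn hphi.
  by exists phi; move: hphi; rewrite subn0.
have [|psi] := proj1 (deriv0_onto_intg_spans n) _ _ _ hphi; first lia.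
rewrite -subSn // subSS => hpsi e.
have [|chi hchi e'] := IH _ _ hpsi; first exact: ltnW.
exists chi => // a s sz.
by rewrite addSnnS e' // -e /= ?sz.
Qed.

End Functionals.

(** * Exponent vectors and shapes *)

Section Placements.

(** The exponent vectors of length n of the monomials of M_alpha. *)
Fixpoint placements (alpha : seq nat) (n : nat) : seq (seq nat) :=
  if n is n'.+1 then
    map (cons 0%N) (placements alpha n') ++
    (if alpha is b :: beta then map (cons b) (placements beta n') else [::])
  else if alpha is [::] then [:: [::]] else [::].

Definition shape (s : seq nat) := filter (leq 1) s.

Lemma mem_map_cons (T : eqType) (x y : T) (s : seq T) (r : seq (seq T)) :
  (x :: s \in map (cons y) r) = (x == y) && (s \in r).
Proof.
apply/mapP/andP => [[t tr [-> ->]]|[/eqP-> sr]]; first by rewrite eqxx.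
by exists s.
Qed.

Lemma mem_placements alpha n t : positive alpha ->
  (t \in placements alpha n) = (size t == n) && (shape t == alpha).
Proof.
elim: n alpha t => [|n IH] alpha t pos.
  by case: t => [|a t]; case: alpha pos.
case: t => [|a t].
  rewrite mem_cat; apply/negP => /orP[/mapP[]//|].
  by case: alpha pos => // b beta _ /mapP[].
rewrite mem_cat mem_map_cons IH // eqSS.
case: alpha pos => [_|b beta /andP[b_gt0 pos]].
  by rewrite orbF; case: a => [|a] //=; rewrite andbF.
rewrite mem_map_cons IH //; case: a => [|a] /=.
  by rewrite [0%N == b]eq_sym -[b == 0%N]negbK -lt0n b_gt0 orbF.
by rewrite eqseq_cons andbCA.
Qed.

Lemma uniq_placements alpha n : positive alpha -> uniq (placements alpha n).
Proof.
have inj (x : nat) : injective (cons x) by move=> ? ? [].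
elim: n alpha => [|n IH] [|b beta] //= pos.
  by rewrite cats0 map_inj_uniq ?IH.
have /andP[b_gt0 pos'] := pos.
rewrite cat_uniq !map_inj_uniq // !IH // andbT /=.
apply/hasPn => _ /mapP[t _ ->]; apply/negP; rewrite /= mem_map_cons.
by case: b b_gt0 {pos}.
Qed.

Lemma mon_act_placements (K : zmodType) alpha (phi : seq nat -> K) nu :
  mon_act alpha phi nu =
  \sum_(t <- placements alpha (size nu))
     phi [seq (p.1 + p.2)%N | p <- zip nu t].
Proof.
elim: nu alpha phi => [|a nu IH] [|b beta] phi /=.
- by rewrite big_seq1.
- by rewrite big_nil.
- by rewrite cats0 big_map addr0 IH /= addn0.
- by rewrite big_cat !big_map !IH /= addn0.
Qed.

End Placements.

(** * Polynomials and their functionals *)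

Section Jets.

Variable n : nat.
Implicit Types (m : 'X_{1..n}) (f : {mpoly rat[n]}).

Definition mnm_of_seq (s : seq nat) : 'X_{1..n} := [multinom nth 0%N s i | i < n].

Lemma mnm_of_seqK s : size s = n -> mnm_of_seq s = s :> seq nat.
Proof.
move=> sz; apply: (@eq_from_nth _ 0%N); first by rewrite size_tuple.
move=> i; rewrite size_tuple => lt_in.
rewrite -[i]/(nat_of_ord (Ordinal lt_in)) -tnth_nth.
by rewrite -[LHS]/(mnm_of_seq s (Ordinal lt_in)) mnmE.
Qed.

Lemma seqK_mnm m : mnm_of_seq m = m.
Proof. by apply/mnmP => i; rewrite mnmE -tnth_nth. Qed.

Lemma sumn_mnm m : sumn m = mdeg m.
Proof. by rewrite mdegE sumnE big_tuple. Qed.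

Lemma mnm_of_seqD s t : size s = n -> size t = n ->
  mnm_of_seq [seq (p.1 + p.2)%N | p <- zip s t] = (mnm_of_seq s + mnm_of_seq t)%MM.
Proof.
move=> ss st; apply/mnmP => i; rewrite mnmDE !mnmE.
by rewrite (nth_map (0, 0)%N) ?size_zip ?ss ?st ?minnn // nth_zip ?ss.
Qed.

Definition jet f (s : seq nat) : rat := (mderivm (mnm_of_seq s) f)@_0%MM.

Definition mfact m := (\prod_(i < n) (m i)`!)%N.

Lemma jetE f s : jet f s = f@_(mnm_of_seq s) *+ mfact (mnm_of_seq s).
Proof.
rewrite /jet mcoeff_mderivm addm0; congr (_ *+ _).
by apply: eq_bigr => i _; rewrite ffactnn.
Qed.

Lemma mfact_neq0 m : (mfact m)%:R != 0 :> rat.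
Proof.
rewrite Num.Theory.pnatr_eq0 -lt0n prodn_gt0 // => i; exact: fact_gt0.
Qed.

Lemma jet_inj f g : (forall s, size s = n -> jet f s = jet g s) -> f = g.
Proof.
move=> e; apply/mpolyP => m; have := e m (size_tuple _).
rewrite !jetE seqK_mnm -[f@__ *+ _]mulr_natr -[g@__ *+ _]mulr_natr.
exact: (mulIf (mfact_neq0 m)).
Qed.

Lemma jet_sum I (r : seq I) (F : I -> {mpoly rat[n]}) s :
  jet (\sum_(i <- r) F i) s = \sum_(i <- r) jet (F i) s.
Proof. by rewrite /jet !raddf_sum. Qed.

Lemma jet_mderivm m f s :
  jet (mderivm m f) s = (mderivm (m + mnm_of_seq s)%MM f)@_0%MM.
Proof. by rewrite /jet mderivmDm. Qed.

(** Taylor expansion at 0, inverse to [jet] in degree d. *)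
Definition of_jet (d : nat) (phi : seq nat -> rat) : {mpoly rat[n]} :=
  \sum_(m : 'X_{1..n < d.+1}) (phi (m : 'X_{1..n}) / (mfact m)%:R) *: 'X_[m].

Lemma mcoeff_of_jet d phi m : homogeneous n d phi ->
  (of_jet d phi)@_m = phi m / (mfact m)%:R.
Proof.
move=> hom; have [lt_md|le_dm] := ltnP (mdeg m) d.+1.
  exact: (mcoeff_mpoly (fun m : 'X_{1..n} => phi m / (mfact m)%:R)).
rewrite hom ?mul0r ?size_tuple ?sumn_mnm ?gtn_eqF //.
rewrite raddf_sum big1 //= => k _; rewrite mcoeffZ mcoeffX.
case: eqP => [km|_]; last by rewrite mulr0.
by have := valP k; rewrite /= km ltnNge le_dm.
Qed.

Lemma jet_of_jet d phi s : homogeneous n d phi -> size s = n ->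
  jet (of_jet d phi) s = phi s.
Proof.
move=> hom sz; rewrite jetE mcoeff_of_jet // mnm_of_seqK // -[LHS]mulr_natr.
by rewrite divfK ?mfact_neq0.
Qed.

Lemma dhomog_of_jet d phi : homogeneous n d phi -> of_jet d phi \is d.-homog.
Proof.
move=> hom; apply/dhomogP => m; rewrite mcoeff_msupp mcoeff_of_jet //.
apply: contraNeq => ne; rewrite hom ?mul0r ?size_tuple //.
by rewrite sumn_mnm.
Qed.

End Jets.

(** * Quasisymmetric harmonics as functionals *)

Lemma sum_fibers_eq0 (V : zmodType) (I K : eqType) (key : I -> K) (r : seq I)
    (F : I -> V) :
  (forall k, \sum_(i <- r | key i == k) F i = 0) -> \sum_(i <- r) F i = 0.
Proof.
elim: {r}_.+1 {-2}r (ltnSn (size r)) => // sz IH [|x r] /= lt_sz h.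
  by rewrite big_nil.
rewrite (bigID (fun i => key i == key x)) /= h add0r -big_filter.
apply: IH => [|k].
  rewrite /= eqxx /= size_filter; exact: leq_ltn_trans (count_size _ _) lt_sz.
rewrite big_filter_cond; have [->|ne_k] := eqVneq k (key x).
  by rewrite big_pred0 // => i; rewrite andbC andbN.
rewrite -[RHS](h k); apply: eq_bigl => i.
by case: (eqVneq (key i) k) => [->|]; rewrite ?andbF // ne_k.
Qed.

Lemma enum_ord_sorted k : sorted (fun i j : 'I_k => i < j)%N (enum 'I_k).
Proof. by have := iota_ltn_sorted 0 k; rewrite -val_enum_ord sorted_map. Qed.

Section Quasisymmetric.

Variable n : nat.
Implicit Types (m : 'X_{1..n}) (f : {mpoly rat[n]}) (g : {mpoly int[n]}).

Definition support_seq m : seq 'I_n := [seq i <- enum 'I_n | (0 < m i)%N].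

Lemma shapeE m : shape m = [seq m i | i <- support_seq m].
Proof.
rewrite /support_seq -(filter_map m (leq 1)) /shape; congr filter.
apply: (@eq_from_nth _ 0%N) => [|i].
  by rewrite size_tuple size_map size_enum_ord.
rewrite size_tuple => lt_in; rewrite (nth_map (Ordinal lt_in)) ?size_enum_ord //.
rewrite -[i in LHS]/(nat_of_ord (Ordinal lt_in)) -tnth_nth.
by rewrite -[i]/(nat_of_ord (Ordinal lt_in)) nth_ord_enum.
Qed.

Lemma shape_positive s : positive (shape s).
Proof. exact: filter_all. Qed.

Lemma support_seq_sorted m : sorted (fun i j : 'I_n => i < j)%N (support_seq m).
Proof.
apply: sorted_filter => [i j k|]; first exact: ltn_trans.
exact: enum_ord_sorted.
Qed.

Lemma pattern_mnmE k (a : 'I_k -> nat) (i : 'I_k -> 'I_n) j :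
  pattern_mnm a i j = (\sum_(t < k) (i t == j) * a t)%N.
Proof.
by rewrite /pattern_mnm mnm_sumE; apply: eq_bigr => t _; rewrite mulmnE mnm1E.
Qed.

Lemma pattern_of_shape m : exists2 i : 'I_(size (shape m)) -> 'I_n,
  strictly_increasing i & pattern_mnm (nth 0%N (shape m)) i = m.
Proof.
have sz : size (support_seq m) == size (shape m) by rewrite shapeE size_map.
pose P := Tuple sz; exists (tnth P) => [s t lt_st|].
  have x0 := tnth P s; rewrite !(tnth_nth x0).
  apply: (sorted_ltn_nth _ _ (support_seq_sorted m)) => //.
  - by move=> x y z; apply: ltn_trans.
  - by rewrite inE (eqP sz).
  - by rewrite inE (eqP sz).
apply/mnmP => j; rewrite pattern_mnmE.
have nthP (t : 'I_(size (shape m))) : nth 0%N (shape m) t = m (tnth P t).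
  have x0 := tnth P t; transitivity (nth 0%N (map m (support_seq m)) t).
    by rewrite -shapeE.
  by rewrite (nth_map x0) ?(eqP sz) // (tnth_nth x0).
under eq_bigr do rewrite nthP.
rewrite -(big_tuple _ _ P xpredT (fun i => (i == j) * m i)%N).
have [mj0|mj_gt0] := posnP (m j).
  by rewrite big1 // => i _; case: eqP => // ->; rewrite mj0.
have jP : j \in support_seq m by rewrite mem_filter mj_gt0 mem_enum.
have uP : uniq (support_seq m) by rewrite filter_uniq ?enum_uniq.
rewrite (bigD1_seq _ jP uP).
rewrite eqxx mul1n big1 => [|i /negbTE-> //]; exact: addn0.
Qed.

Lemma shape_pattern k (a : 'I_k -> nat) (i : 'I_k -> 'I_n) :
  (forall t, 1 <= a t)%N -> strictly_increasing i ->
  shape (pattern_mnm a i) = [seq a t | t <- enum 'I_k].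
Proof.
move=> a_gt0 inc; have inj : injective i.
  move=> s t e; apply/val_inj; case: (ltngtP s t) => // /inc; rewrite e ltnn //.
have val_at t : pattern_mnm a i (i t) = a t.
  rewrite pattern_mnmE (bigD1 t) //= eqxx mul1n big1 ?addn0 // => s ne_st.
  by rewrite (inj_eq inj) (negbTE ne_st).
rewrite shapeE; have -> : support_seq (pattern_mnm a i) = map i (enum 'I_k).
  apply: (irr_sorted_eq (leT := fun i j : 'I_n => (i < j)%N)).
  - by move=> x y z; apply: ltn_trans.
  - by move=> x; apply: ltnn.
  - exact: support_seq_sorted.
  - rewrite sorted_map; apply: sub_sorted (_ : sorted (fun s t : 'I_k => (s < t)%N) _).
      by move=> s t /inc.
    exact: enum_ord_sorted.
  move=> j; rewrite mem_filter mem_enum andbT; apply/idP/mapP => [|[t _ ->]].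
    rewrite pattern_mnmE lt0n sum_nat_eq0 negb_forall => /existsP[t /=].
    by case: (i t =P j) => [<- _|//]; exists t; rewrite ?mem_enum.
  by rewrite val_at.
by rewrite -map_comp; apply: eq_map => t /=.
Qed.

(** A monomial is determined by its sequence of nonzero exponents together with
    their increasing positions, so quasisymmetry says that coefficients depend
    only on the former. *)
Lemma QSymP g : QSym g <-> forall m m', shape m = shape m' -> g@_m = g@_m'.
Proof.
split=> [qs m m' e|h k a a_gt0 i j inc_i inc_j]; last first.
  by apply: h; rewrite !shape_pattern.
have [i inc_i <-] := pattern_of_shape m.
have [] := pattern_of_shape m'; rewrite -e => j inc_j <-.
apply: qs => // t; have /all_nthP := shape_positive m; exact.
Qed.

Lemma apply_diffopE g f (r : seq 'X_{1..n}) : uniq r ->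
    {subset msupp g <= r} ->
  apply_diffop g f = \sum_(m <- r) (g@_m)%:~R *: mderivm m f.
Proof.
move=> uniq_r sub; rewrite [RHS](bigID (mem (msupp g))) /= [X in _ + X]big1.
  rewrite addr0 -big_filter /apply_diffop; apply: perm_big; apply: uniq_perm.
  - exact: msupp_uniq.
  - exact: filter_uniq.
  by move=> m; rewrite mem_filter andb_idr //; apply: sub.
by move=> m /memN_msupp_eq0->; rewrite scale0r.
Qed.

(** M_alpha itself. *)
Definition mon_qsym alpha : {mpoly int[n]} :=
  \sum_(m <- map (mnm_of_seq n) (placements alpha n)) 'X_[m].

Lemma uniq_placement_mnms alpha : positive alpha ->
  uniq (map (mnm_of_seq n) (placements alpha n)).
Proof.
move=> pos; rewrite map_inj_in_uniq ?uniq_placements // => s t.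
rewrite !mem_placements // => /andP[/eqP ss _] /andP[/eqP st _].
by move/(congr1 (fun m : 'X_{1..n} => m : seq nat)); rewrite !mnm_of_seqK.
Qed.

Lemma mem_placement_mnms alpha m : positive alpha ->
  (m \in map (mnm_of_seq n) (placements alpha n)) = (shape m == alpha).
Proof.
move=> pos; apply/mapP/idP => [[t]|sh].
  by rewrite mem_placements // => /andP[/eqP st sh] ->; rewrite mnm_of_seqK.
by exists (m : seq nat); rewrite ?seqK_mnm // mem_placements // size_tuple eqxx.
Qed.

Lemma mcoeff_mon_qsym alpha m : positive alpha ->
  (mon_qsym alpha)@_m = (shape m == alpha)%:R.
Proof.
move=> pos; rewrite -mem_placement_mnms // raddf_sum /=.
under eq_bigr do rewrite mcoeffX.
set r := map _ _; have ur : uniq r := uniq_placement_mnms pos.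
have [mr|mr] := boolP (m \in r).
  rewrite (bigD1_seq m) //= eqxx big1 ?addr0 // => k /negbTE->.
  by [].
by rewrite big_seq big1 // => k kr; case: eqP => // km; rewrite -km kr in mr.
Qed.

Lemma mon_act_jet alpha f m : positive alpha ->
  mon_act alpha (jet f) m =
  \sum_(k <- map (mnm_of_seq n) (placements alpha n)) (mderivm (k + m)%MM f)@_0%MM.
Proof.
move=> pos; rewrite mon_act_placements size_tuple big_map.
rewrite big_seq [RHS]big_seq; apply: eq_bigr => t.
rewrite mem_placements // => /andP[/eqP st _].
by rewrite /jet mnm_of_seqD ?size_tuple // seqK_mnm addmC.
Qed.

Lemma shape0 : shape (0%MM : 'X_{1..n}) = [::].
Proof.
rewrite shapeE /support_seq (eq_filter (a2 := pred0)) ?filter_pred0 // => i.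
by rewrite mnm0E.
Qed.

Lemma harmonic_of_HQSym f : HQSym f -> harmonic n (jet f).
Proof.
move=> hf alpha nz pos nu sz; rewrite -(mnm_of_seqK sz) mon_act_jet //.
have h : apply_diffop (mon_qsym alpha) f = 0.
  apply: hf; last by rewrite mcoeff_mon_qsym // shape0 eq_sym (negbTE nz).
  by apply/QSymP => m m' e; rewrite !mcoeff_mon_qsym // e.
set m := mnm_of_seq n nu.
transitivity (mderivm m (apply_diffop (mon_qsym alpha) f))@_0%MM; last first.
  by rewrite h raddf0 mcoeff0.
rewrite (apply_diffopE _ (uniq_placement_mnms pos)) => [|k]; last first.
  rewrite mcoeff_msupp mcoeff_mon_qsym // mem_placement_mnms //.
  by case: (shape k == alpha).
rewrite !raddf_sum /= big_seq [RHS]big_seq; apply: eq_bigr => k.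
rewrite mem_placement_mnms // => sh.
by rewrite mcoeff_mon_qsym // sh scale1r mderivmDm.
Qed.

(** On each class of monomials of equal shape alpha the coefficients of g agree,
    so the terms of this shape add up to a multiple of the action of M_alpha;
    alpha is nonempty because g has no constant term. *)
Lemma HQSym_of_harmonic f : harmonic n (jet f) -> HQSym f.
Proof.
move=> hf g /QSymP qs g0; apply: jet_inj => s sz.
rewrite /apply_diffop jet_sum [RHS]/jet raddf0 mcoeff0.
apply: (sum_fibers_eq0 (key := fun m : 'X_{1..n} => shape m)) => alpha.
have [/hasP[k kg /eqP sh]|/hasPn no] :=
    boolP (has (fun m : 'X_{1..n} => shape m == alpha) (msupp g)); last first.
  by rewrite big_seq_cond big_pred0 // => m; apply/andP => -[/no/negP].
have pos : positive alpha by rewrite -sh shape_positive.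
have nz : alpha != [::].
  apply: contraTneq kg => a0; rewrite mcoeff_msupp negbK (qs k 0%MM) ?g0 //.
  by rewrite sh a0 shape0.
rewrite -big_filter.
transitivity ((g@_k)%:~R * mon_act alpha (jet f) s); last by rewrite hf ?mulr0.
rewrite -(mnm_of_seqK sz) mon_act_jet // mulr_sumr.
set r := [seq _ <- _ | _].
have eq_r : perm_eq r (map (mnm_of_seq n) (placements alpha n)).
  apply: uniq_perm; rewrite ?filter_uniq ?msupp_uniq ?uniq_placement_mnms //.
  move=> m; rewrite mem_placement_mnms // mem_filter andb_idr // => /eqP shm.
  by move: kg; rewrite !mcoeff_msupp (qs k m) ?sh ?shm.
rewrite -(perm_big _ eq_r) /= big_seq [RHS]big_seq; apply: eq_bigr => m.
rewrite mem_filter => /andP[/eqP shm _].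
rewrite /jet mnm_of_seqK // mderivmZ mcoeffZ mderivmDm (qs m k) ?sh ?shm //.
Qed.

End Quasisymmetric.

(** * Derivatives of top degree harmonics *)

Lemma apply_diffop_mderivm n (g : {mpoly int[n]}) m f :
  apply_diffop g (mderivm m f) = mderivm m (apply_diffop g f).
Proof.
rewrite /apply_diffop raddf_sum; apply: eq_bigr => k _.
by rewrite /= mderivmZ -!mderivmDm addmC.
Qed.

Lemma HQSym_mderivm n m (f : {mpoly rat[n]}) : HQSym f -> HQSym (mderivm m f).
Proof. by move=> h g qs g0; rewrite apply_diffop_mderivm h ?raddf0. Qed.

Lemma HQSym_sum n r (c : 'I_r -> rat) (w : 'I_r -> {mpoly rat[n]}) :
  (forall t, HQSym (w t)) -> HQSym (\sum_(t < r) c t *: w t).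
Proof.
move=> h g qs g0.
transitivity (\sum_(t < r) c t *: apply_diffop g (w t)).
  under [RHS]eq_bigr do rewrite /apply_diffop scaler_sumr.
  rewrite [RHS]exchange_big /=; apply: eq_bigr => m _.
  rewrite raddf_sum scaler_sumr; apply: eq_bigr => t _.
  by rewrite /= mderivmZ !scalerA mulrC.
by apply: big1 => t _; rewrite h ?scaler0.
Qed.

Definition graded_part (K : zmodType) d (phi : seq nat -> K) s :=
  if sumn s == d then phi s else 0.

(** M_alpha is homogeneous, hence the homogeneous components of a harmonic
    polynomial are harmonic. *)
Lemma harmonic_graded_part (K : zmodType) n d (phi : seq nat -> K) :
  harmonic n phi -> harmonic_deg n d (graded_part d phi).
Proof.
move=> h; split; last by move=> nu _ /negbTE ne; rewrite /graded_part ne.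
move=> alpha nz pos nu sz.
have [e|ne] := eqVneq (sumn alpha + sumn nu)%N d.
  rewrite (@eq_mon_act _ _ _ phi) ?h // => s _ sm.
  by rewrite /graded_part sm e eqxx.
by apply: mon_act_eq0 => s _ sm; rewrite /graded_part sm (negbTE ne).
Qed.

Lemma HQSym_graded_part n d (f : {mpoly rat[n.+1]}) : (d <= n)%N -> HQSym f ->
  exists2 g, HQSym g /\ g \is n.-homog &
    forall s, size s = n.+1 ->
      jet (mderivm (U_(ord0 : 'I_n.+1) *+ (n - d))%MM g) s = graded_part d (jet f) s.
Proof.
move=> le_dn /harmonic_of_HQSym hf.
have := @harmonic_iter_deriv0 _ n (n - d) (graded_part d (jet f)) (leq_subr _ _).
rewrite subKn // => /(_ (harmonic_graded_part d hf))[psi [hpsi opsi] e].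
exists (of_jet n.+1 n psi).
  split; last exact: dhomog_of_jet.
  by apply: HQSym_of_harmonic; apply: eq_harmonic hpsi => s sz; rewrite jet_of_jet.
move=> [|a s] // [sz]; rewrite jet_mderivm -e //.
rewrite -(jet_of_jet opsi) ?/= ?sz // /jet; congr (mderivm _ _)@_0.
apply/mnmP => -[[|i] lt_i]; rewrite mnmDE mulmnE mnm1E !mnmE /= ?mul1n //.
Qed.

Theorem theorem10p13 (n : nat) (hn : (1 <= n)%N) (f : {mpoly rat[n]}) :
  HQSym f <->
  in_span (derivative_of (fun g : {mpoly rat[n]} =>
             HQSym g /\ g \is (n - 1)%N.-homog)) f.
Proof.
split=> [hf|[r [c [w [hw ->]]]]]; last first.
  by apply: HQSym_sum => t; have [m [g [[hg _] ->]]] := hw t; apply: HQSym_mderivm.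
case: n hn f hf => // n _ f hf; rewrite subn1 /=.
have part (t : 'I_n.+1) : exists2 g, HQSym g /\ g \is n.-homog &
    forall s, size s = n.+1 ->
      jet (mderivm (U_(ord0 : 'I_n.+1) *+ (n - t))%MM g) s = graded_part t (jet f) s.
  by apply: HQSym_graded_part => //; rewrite -ltnS.
have [G hG eG] := fin_all_exists2 part.
exists n.+1, (fun=> 1).
exists (fun t : 'I_n.+1 => mderivm (U_(ord0 : 'I_n.+1) *+ (n - t))%MM (G t)).
split=> [t|]; first by exists (U_(ord0 : 'I_n.+1) *+ (n - t))%MM, (G t).
apply: jet_inj => s sz; rewrite jet_sum.
under eq_bigr do rewrite scale1r eG //.
have [lt_s|le_s] := ltnP (sumn s) n.+1.
  rewrite (bigD1 (Ordinal lt_s)) //= /graded_part eqxx big1 ?addr0 // => t.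
  by rewrite -val_eqE /= eq_sym => /negbTE->.
have [h o] := harmonic_graded_part (sumn s) (harmonic_of_HQSym hf).
have := harmonic_top _ h o sz; rewrite le_s {1}/graded_part eqxx => -> //.
by rewrite big1 // => t _; rewrite /graded_part gtn_eqF // (leq_trans (ltn_ord t)).
Qed.
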